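(* Let $N\ge 1$, let $f:[N]\to\{0,1\}$ be a Boolean function, and suppose we are given a quantum $\varepsilon$-biased oracle $O^{\varepsilon}_f$ for $f$ together with the value of $\varepsilon$. Then there exists a quantum algorithm that computes $\mathrm{OR}(f(1),\dots,f(N))$ with probability at least $2/3$ using $O(\sqrt{N}/\varepsilon)$ queries to $O^{\varepsilon}_f$. Moreover, if the value $\varepsilon_{\min}$ is known, the algorithm uses $\Theta(\sqrt{N}/\varepsilon_{\min})$ queries.
   Context: A quantum oracle of a Boolean function $f:[N]\to\{0,1\}$ with bias $\varepsilon$ (an $\varepsilon$-biased oracle) is a unitary transformation $O^{\varepsilon}_f$ (queries may use $O^{\varepsilon}_f$ or its inverse ${O^{\varepsilon}_f}^\dagger$) such that for every $x\in[N]$, $O^{\varepsilon}_f\ket{x}\ket{0^{m-1}}\ket{0}=\ket{x}\big(\alpha_x\ket{w_x}\ket{f(x)}+\beta_x\ket{w'_x}\ket{\overline{f(x)}}\big)$, where $\ket{w_x},\ket{w'_x}$ are normalized states of the $(m-1)$-qubit work register and $|\alpha_x|^2=1/2+\varepsilon_x\ge 1/2+\varepsilon$. Here $\varepsilon_{\min}=\min_x\varepsilon_x$, so $0<\varepsilon\le\varepsilon_{\min}\le\varepsilon_x\le 1/2$. The query complexity is the number of applications of the oracle (or its inverse) in a quantum algorithm $U_0\to O_1\to U_1\to\cdots\to O_T\to U_T$, where the $U_i$ are arbitrary oracle-independent unitaries. *)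

(* Defs.v *)
From mathcomp Require Import all_boot all_order all_algebra.
From mathcomp Require Import reals.
From mathcomp.real_closed Require Import complex.
Set Implicit Arguments. Unset Strict Implicit. Unset Printing Implicit Defensive.
Import GRing.Theory Num.Theory.
Local Open Scope ring_scope.

Section QuantumQuery.
Variable R : realType.
Local Notation C := R[i].

Definition qstate (S : finType) := S -> C.
Definition qop (S : finType) := S -> S -> C.   (* matrix: U s t = <s|U|t> *)

Definition sqmod (z : C) : R := complex.Re z ^+ 2 + complex.Im z ^+ 2.

Definition ket (S : finType) (s : S) : qstate S := fun t => (t == s)%:R.

Definition apply (S : finType) (U : qop S) (v : qstate S) : qstate S :=
  fun s => \sum_(t : S) U s t * v t.

Definition adjoint (S : finType) (U : qop S) : qop S :=
  fun s t => conjc (U t s).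

(** U^dagger U = I  (for finite dimension, equivalent to unitarity) *)
Definition unitary (S : finType) (U : qop S) : Prop :=
  forall s t, \sum_(u : S) conjc (U u s) * U u t = (s == t)%:R.

Definition normalized (S : finType) (v : qstate S) : Prop :=
  \sum_(s : S) sqmod (v s) = 1.

(** Register of k qubits: basis states are bit strings. *)
Definition qubits (k : nat) := {ffun 'I_k -> bool}.
Definition zeros (k : nat) : qubits k := [ffun => false].

(** Oracle space: |x> (x in [N]) , (m-1)-qubit work register (k = m-1), answer qubit. *)
Definition ospace (N k : nat) := ('I_N * qubits k * bool)%type.

(** Biased oracle with per-input biases epsx : for all x,
    O |x>|0^{m-1}>|0> = |x> (alpha_x |w_x>|f x> + beta_x |w'_x>|~f x>),
    with w_x, w'_x normalized and |alpha_x|^2 = 1/2 + epsx x. *)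
Definition biased_oracle (N k : nat) (f : 'I_N -> bool) (O : qop (ospace N k))
  (epsx : 'I_N -> R) : Prop :=
  unitary O /\
  forall x : 'I_N, exists (alpha beta : C) (w w' : qstate (qubits k)),
    [/\ normalized w, normalized w',
        sqmod alpha = 2^-1 + epsx x &
        forall y v b,
          apply O (ket (x, zeros k, false)) (y, v, b) =
          (y == x)%:R *
          (alpha * w v * (b == f x)%:R + beta * w' v * (b == ~~ f x)%:R)].

Definition eps_biased_oracle (N k : nat) (f : 'I_N -> bool) (O : qop (ospace N k))
  (eps : R) : Prop :=
  exists epsx, biased_oracle f O epsx /\ forall x, eps <= epsx x.

Definition oracle_with_min_bias (N k : nat) (f : 'I_N -> bool) (O : qop (ospace N k))
  (e : R) : Prop :=
  exists epsx, biased_oracle f O epsx /\ (forall x, e <= epsx x) /\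
               (exists x, epsx x = e).

(** Full algorithm space: oracle space tensored with an a-qubit ancilla. *)
Definition aspace (N k a : nat) := (ospace N k * qubits a)%type.

Definition query (N k a : nat) (O : qop (ospace N k)) (dag : bool) : qop (aspace N k a) :=
  fun s t => (if dag then adjoint O s.1 t.1 else O s.1 t.1) * (s.2 == t.2)%:R.

(** A T-query algorithm U_0 -> O_1 -> U_1 -> ... -> O_T -> U_T:
    initial basis state s0, first unitary U0, then steps (dag_i, U_i), i = 1..T,
    where dag_i says whether the i-th query is O or O^dagger;
    final measurement in the computational basis followed by the
    classical post-processing out. *)
Record algorithm (N k a : nat) := Algorithm {
  alg_init : aspace N k a;
  alg_U0 : qop (aspace N k a);
  alg_steps : seq (bool * qop (aspace N k a));
  alg_out : aspace N k a -> bool }.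

Definition queries (N k a : nat) (A : algorithm N k a) : nat := size (alg_steps A).

Definition valid_algorithm (N k a : nat) (A : algorithm N k a) : Prop :=
  unitary (alg_U0 A) /\ forall i, (i < size (alg_steps A))%N -> unitary (nth (false, alg_U0 A) (alg_steps A) i).2.

Definition final_state (N k a : nat) (A : algorithm N k a) (O : qop (ospace N k))
  : qstate (aspace N k a) :=
  foldl (fun psi p => apply p.2 (apply (@query N k a O p.1) psi))
        (apply (alg_U0 A) (ket (alg_init A))) (alg_steps A).

Definition prob_output (N k a : nat) (A : algorithm N k a) (O : qop (ospace N k))
  (b : bool) : R :=
  \sum_(s : aspace N k a | alg_out A s == b) sqmod (final_state A O s).

Definition OR (N : nat) (f : 'I_N -> bool) : bool := [exists x, f x].

End QuantumQuery.

(* Main.v *)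
(** The biased oracle is turned into a phase: conjugating the sign of the answer
    qubit by [O] maps |x,0,0> to d_x |x,0,0> + g_x, where g_x avoids all inputs
    |y,0,0> and d_x = 2 eps_x or -2 eps_x according to f x.  Copies of this
    reflection are strung into a one-dimensional scattering chain.  At zero
    frequency the chain carries an exponentially decaying standing wave that
    reflects |x,0,0> with the exact sign of d_x, and whose squared norm is only
    O(1 / |d_x|).  Grover's vertex reflection joins the N chains, with edge
    weight al = N^(-1/4), to a flag state; the joint stationary state ("catalyst")
    has squared norm O(sqrt N / eps), and one round leaves it in place while
    multiplying the flag by +1 if OR f holds and by -1 otherwise.
    The rounds t = 0, ..., K-1 act on K successive flags, prepared in uniform
    superposition together with K idle flags.  Since the K rounds share one catalyst,
    starting without it changes the final state only by its norm relative to
    sqrt K, so K = O(sqrt N / eps) rounds suffice and no logarithm is lost. *)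
Require Import Defs.
From mathcomp Require Import all_boot all_order all_algebra.
From mathcomp Require Import boolp reals.
From mathcomp.real_closed Require Import complex.
From mathcomp Require Import ring lra zify.
Import Order.TTheory GRing.Theory Num.Theory.
Local Open Scope ring_scope.
Set Implicit Arguments.
Unset Strict Implicit.
Unset Printing Implicit Defensive.

(** * States and unitaries *)

Section States.
Variables (R : realType) (S : finType).
Local Notation C := R[i].
Local Notation "x %:C" := (real_complex R x).
Implicit Types (u v : qstate R S) (U V : qop R S) (T : qstate R S -> qstate R S).

Definition norm2 v : R := \sum_s sqmod (v s).

Lemma sqmodE (z : C) : (sqmod z)%:C = conjc z * z.
Proof. by rewrite /sqmod add_Re2_Im2 sqr_normc mulrC. Qed.

Lemma sqmod_ge0 (z : C) : 0 <= sqmod z.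
Proof. by rewrite addr_ge0 ?sqr_ge0. Qed.

Lemma sqmod0 : sqmod 0 = 0 :> R.
Proof. by rewrite /sqmod /= expr0n addr0. Qed.

Lemma sqmodM (y z : C) : sqmod (y * z) = sqmod y * sqmod z.
Proof. by apply: complexI; rewrite rmorphM /= !sqmodE rmorphM /=; ring. Qed.

Lemma sqmod_real (x : R) : sqmod x%:C = x ^+ 2.
Proof. by rewrite /sqmod /= expr0n addr0. Qed.

Lemma sqmod_norm (z : C) : (sqmod z)%:C = `|z| ^+ 2.
Proof. by rewrite sqmodE sqr_normc mulrC. Qed.

Lemma sqmod_le_norm (z : C) (b : R) :
  0 <= b -> sqmod z <= b ^+ 2 -> `|z| <= b%:C.
Proof.
move=> b0 le_zb; rewrite -(@ler_pXn2r _ 2) ?nnegrE ?normr_ge0 ?ler0c //.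
by rewrite -sqmod_norm -rmorphXn /= lecR.
Qed.

Lemma sqmod_le_norm2 v s : sqmod (v s) <= norm2 v.
Proof.
rewrite /norm2 (bigD1 s) //= lerDl; apply: sumr_ge0 => t _; exact: sqmod_ge0.
Qed.

Lemma norm2E v : (norm2 v)%:C = \sum_s conjc (v s) * v s.
Proof. by rewrite rmorph_sum; apply: eq_bigr => s _; rewrite /= sqmodE. Qed.

Lemma norm2_ket s : norm2 (ket R s) = 1.
Proof.
rewrite /norm2 (bigD1 s) //= /ket eqxx big1 ?addr0 => [|t /negbTE->].
  by rewrite /sqmod /= expr1n expr0n addr0.
exact: sqmod0.
Qed.

Lemma sum_delta (F : S -> C) s : \sum_t (t == s)%:R * F t = F s.
Proof.
rewrite (bigD1 s) //= eqxx mul1r big1 ?addr0 // => t /negbTE->.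
by rewrite mul0r.
Qed.

Lemma sum_delta_sym (F : S -> C) s : \sum_t (s == t)%:R * F t = F s.
Proof. by under eq_bigr => t _ do rewrite eq_sym; apply: sum_delta. Qed.

Lemma apply_ket U t s : apply U (ket R t) s = U s t.
Proof.
by rewrite /apply /ket; under eq_bigr => r _ do rewrite mulrC; apply: sum_delta.
Qed.

(** Phrased for maps on states instead of matrices, so that it covers [foldl] of rounds and the sign
    flip inside [kickback]. *)
Definition linear_isometry T :=
  (forall a u v, T (fun s => a * u s + v s) = fun s => a * T u s + T v s) /\
  (forall u, norm2 (T u) = norm2 u).

Lemma isometry_id : linear_isometry id. Proof. by []. Qed.

Lemma isometry_comp T1 T2 :
  linear_isometry T1 -> linear_isometry T2 -> linear_isometry (T1 \o T2).
Proof.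
move=> [L1 N1] [L2 N2]; split=> [a u v|u] /=; first by rewrite L2 L1.
by rewrite N1 N2.
Qed.

Section Linearity.
Variables (T : qstate R S -> qstate R S) (isoT : linear_isometry T).

Lemma isometryP a u v s : T (fun s => a * u s + v s) s = a * T u s + T v s.
Proof. by rewrite isoT.1. Qed.

Lemma isometryD u v s : T (fun s => u s + v s) s = T u s + T v s.
Proof.
rewrite -[T u s]mul1r -isometryP; congr (T _ s); apply: funext => r.
by rewrite mul1r.
Qed.

Lemma isometry0 s : T (fun=> 0) s = 0.
Proof.
have := isometryD (fun=> 0) (fun=> 0) s; rewrite addr0.
by move/eqP; rewrite -subr_eq0 opprD addNKr oppr_eq0 => /eqP.
Qed.

Lemma isometryZ a u s : T (fun s => a * u s) s = a * T u s.
Proof.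
rewrite -[RHS]addr0 -(isometry0 s) -isometryP; congr (T _ s).
by apply: funext => r; rewrite addr0.
Qed.

Lemma isometryB u v s : T (fun s => u s - v s) s = T u s - T v s.
Proof.
rewrite addrC -mulN1r -isometryP; congr (T _ s); apply: funext => r; ring.
Qed.

Lemma isometry_le_norm u s (b : R) :
  0 <= b -> norm2 u <= b ^+ 2 -> `|T u s| <= b%:C.
Proof.
move=> b0 le_ub; apply: sqmod_le_norm b0 _.
by rewrite (le_trans (sqmod_le_norm2 _ _)) // isoT.2.
Qed.

End Linearity.

Lemma unitary_isometry U : unitary U -> linear_isometry (apply U).
Proof.
move=> unitU; split=> [a u v|u].
  apply: funext => s; rewrite /apply mulr_sumr -big_split /=.
  by apply: eq_bigr => t _; ring.
apply: complexI; rewrite !norm2E /apply.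
transitivity (\sum_r \sum_t conjc (u r) * u t * \sum_s conjc (U s r) * U s t).
  under [RHS]eq_bigr => r _ do under eq_bigr => t _ do rewrite mulr_sumr.
  under [RHS]eq_bigr => r _ do rewrite exchange_big.
  rewrite [RHS]exchange_big; apply: eq_bigr => s _ /=.
  rewrite rmorph_sum /= mulr_suml; apply: eq_bigr => r _.
  rewrite mulr_sumr; apply: eq_bigr => t _; rewrite rmorphM /=; ring.
apply: eq_bigr => r _; under eq_bigr => t _ do rewrite unitU mulrC.
by rewrite sum_delta_sym.
Qed.

(** * Unitary building blocks: products, adjoints, diagonal, permutation and reflection operators *)

Definition opmul U V : qop R S := fun s t => \sum_r U s r * V r t.

Lemma apply_opmul U V v : apply (opmul U V) v = apply U (apply V v).
Proof.
apply: funext => s; rewrite /apply /opmul.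
under eq_bigr => t _ do rewrite mulr_suml.
rewrite exchange_big /=; apply: eq_bigr => r _; rewrite mulr_sumr.
by apply: eq_bigr => t _; rewrite mulrA.
Qed.

Lemma unitary_opmul U V : unitary U -> unitary V -> unitary (opmul U V).
Proof.
move=> unitU unitV s t; rewrite -unitV.
transitivity (\sum_q \sum_r conjc (V q s) * V r t * \sum_u conjc (U u q) * U u r).
  under [RHS]eq_bigr => q _ do under eq_bigr => r _ do rewrite mulr_sumr.
  under [RHS]eq_bigr => q _ do rewrite exchange_big.
  rewrite [RHS]exchange_big; apply: eq_bigr => u _ /=.
  rewrite /opmul rmorph_sum /= mulr_suml; apply: eq_bigr => r _.
  rewrite mulr_sumr; apply: eq_bigr => q _; rewrite rmorphM /=; ring.
apply: eq_bigr => q _; under eq_bigr => r _ do rewrite unitU mulrC.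
by rewrite sum_delta_sym.
Qed.

(** [unitary] makes the adjoint a left inverse; for square matrices a left inverse is a right
    inverse, hence the transcription to ['M_#|S|]. *)
Lemma unitary_adjoint U : unitary U -> unitary (adjoint U).
Proof.
move=> unitU s t.
pose M : 'M[C]_#|S| := \matrix_(i, j) U (enum_val i) (enum_val j).
pose M' : 'M[C]_#|S| := \matrix_(i, j) conjc (U (enum_val j) (enum_val i)).
have : M' *m M = 1%:M.
  apply/matrixP => i j; rewrite !mxE -(inj_eq enum_val_inj) -unitU.
  rewrite [RHS](reindex _ (onW_bij _ (@enum_val_bij S))) /=.
  by apply: eq_bigr => r _; rewrite !mxE.
move/mulmx1C/matrixP/(_ (enum_rank s) (enum_rank t)).
rewrite !mxE (inj_eq enum_rank_inj) => <-.
rewrite (reindex _ (onW_bij _ (@enum_val_bij S))) /=.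
by apply: eq_bigr => r _; rewrite !mxE !enum_rankK /adjoint conjcK.
Qed.

Lemma adjoint_apply U v : unitary U -> apply (adjoint U) (apply U v) = v.
Proof.
move=> unitU; rewrite -apply_opmul; apply: funext => s.
rewrite /apply; under eq_bigr => t _ do rewrite (unitU s t : opmul _ _ _ _ = _).
exact: sum_delta_sym.
Qed.

Lemma adjointK U : adjoint (adjoint U) = U.
Proof. by apply: funext => s; apply: funext => t; rewrite /adjoint conjcK. Qed.

Definition diag_op (ph : S -> C) : qop R S := fun s t => (s == t)%:R * ph t.

Lemma apply_diag ph v s : apply (diag_op ph) v s = ph s * v s.
Proof.
rewrite /apply /diag_op; under eq_bigr => t _ do rewrite -mulrA.
exact: sum_delta_sym.
Qed.

Lemma unitary_diag ph : (forall s, conjc (ph s) * ph s = 1) -> unitary (diag_op ph).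
Proof.
move=> ph1 s t; rewrite /diag_op.
under eq_bigr => u _ do rewrite rmorphM /= conjc_nat -mulrA.
by rewrite sum_delta [LHS]mulrCA mulrC; case: eqP => [->|]; rewrite ?ph1 ?mulr1 ?mulr0.
Qed.

Definition perm_op (p : S -> S) : qop R S := fun s t => (t == p s)%:R.

Lemma apply_perm p v s : apply (perm_op p) v s = v (p s).
Proof. exact: sum_delta. Qed.

Lemma unitary_perm p : involutive p -> unitary (perm_op p).
Proof.
move=> pK s t; rewrite /perm_op.
under eq_bigr => u _ do rewrite conjc_nat eq_sym (can2_eq pK pK).
by rewrite sum_delta pK eq_sym.
Qed.

(* For [w = 0] the coefficient is [2 / 0 = 0] and this is the identity. *)
Definition refl_op (w : S -> R) : qop R S :=
  fun s t => (s == t)%:R - (2 / (\sum_r w r ^+ 2) * w s * w t)%:C.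

Lemma apply_refl w v s :
  apply (refl_op w) v s =
  v s - (2 / (\sum_r w r ^+ 2) * w s)%:C * \sum_t (w t)%:C * v t.
Proof.
rewrite /apply /refl_op; under eq_bigr => t _ do rewrite mulrBl.
rewrite sumrB sum_delta_sym mulr_sumr; congr (_ - _); apply: eq_bigr => t _.
by rewrite [in LHS]rmorphM /= mulrA.
Qed.

Lemma unitary_refl w : unitary (refl_op w).
Proof.
move=> s t; rewrite /refl_op; set W := \sum_r w r ^+ 2; set c := 2 / W.
(* Unitarity reduces to this identity: the quadratic term cancels the two linear ones. At [W = 0] it
   holds because [c = 0]. *)
have cW : c * c * W = 2 * c.
  rewrite /c; have [->|W0] := eqVneq W 0; first by rewrite invr0; ring.
  by field.
transitivity (\sum_u ((u == s)%:R * ((u == t)%:R - (c * w u * w t)%:C)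
   - (u == t)%:R * (c * w u * w s)%:C + (c * c * w s * w t * w u ^+ 2)%:C)).
  apply: eq_bigr => u _; have -> (x y : C) : conjc (x - y) = conjc x - conjc y by exact: rmorphB.
  rewrite conjc_nat conjc_real !rmorphM /=; ring.
rewrite big_split sumrB /= !sum_delta -rmorph_sum -mulr_sumr -/W.
rewrite -addrA -addrA -[RHS]addr0; congr (_ + _).
rewrite addrA -opprD addrC; apply/eqP; rewrite subr_eq0; apply/eqP.
rewrite -rmorphD; congr (_%:C).
have -> : c * c * w s * w t * W = c * c * W * w s * w t by ring.
rewrite cW; ring.
Qed.

Lemma unitary_one : unitary (diag_op (fun=> 1)).
Proof. by apply: unitary_diag => s; rewrite conjc1 mulr1. Qed.

Lemma apply_one v : apply (diag_op (fun=> 1)) v = v.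
Proof. by apply: funext => s; rewrite apply_diag mul1r. Qed.

(* The map [W] stands for the part of a run still to come. *)
Lemma telescope_isometry (T : nat -> qstate R S -> qstate R S)
  (u e : nat -> qstate R S) (K : nat) (eta : R) s :
  (forall t, (t < K)%N -> linear_isometry (T t)) ->
  (forall t r, (t < K)%N -> T t (u t) r = u t.+1 r + e t r) ->
  0 <= eta -> (forall t, (t < K)%N -> norm2 (e t) <= eta ^+ 2) ->
  forall (W : qstate R S -> qstate R S), linear_isometry W ->
  `|W (foldl (fun v t => T t v) (u 0%N) (iota 0 K)) s - W (u K) s|
    <= (K%:R * eta)%:C.
Proof.
elim: K => [|K IH] isoT stepT eta0 le_e W isoW.
  by rewrite /= subrr normr0 mul0r.
rewrite -[in iota _ _]addn1 iotaD foldl_cat /= add0n.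
set v := foldl _ _ _.
have isoK := isoT _ (ltnSn K).
(* The last step is absorbed into the remaining run: the induction hypothesis is used with [W]
   composed with [T K]. *)
have := IH (fun t tK => isoT t (ltnW tK)) (fun t r tK => stepT t r (ltnW tK)) eta0
  (fun t tK => le_e t (ltnW tK)) _ (isometry_comp isoW isoK).
rewrite /= -/v => IHK.
have eWK : W (T K (u K)) s = W (u K.+1) s + W (e K) s.
  rewrite -isometryD //; congr (W _ s); apply: funext => r; exact: stepT.
have le_eK := isometry_le_norm isoW s eta0 (le_e _ (ltnSn K)).
have -> : W (T K v) s - W (u K.+1) s =
  (W (T K v) s - W (T K (u K)) s) + W (e K) s by rewrite eWK; ring.
apply: le_trans (ler_normD _ _) _.
rewrite -natr1 mulrDl mul1r rmorphD /=; exact: lerD.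
Qed.

End States.

(** * The oracle as a phase *)

Section PhaseKickback.
Variables (R : realType) (N k : nat).
Local Notation C := R[i].
Local Notation "x %:C" := (real_complex R x).
Local Notation basis := (ospace N k).
Implicit Types (o : basis) (x y : 'I_N) (kappa gamma : 'I_N -> R).

Definition input_state x : basis := (x, zeros k, false).

Definition is_input o : bool := (o.1.2 == zeros k) && ~~ o.2.

Lemma is_inputP o : is_input o -> o = input_state o.1.1.
Proof. by case: o => [[x v] b]; rewrite /is_input /= => /andP[/eqP-> /negbTE->]. Qed.

Lemma is_input_state x : is_input (input_state x).
Proof. by rewrite /is_input eqxx. Qed.

Lemma sum_input (V : nmodType) (F : basis -> V) :
  \sum_(o | is_input o) F o = \sum_x F (input_state x).
Proof.
rewrite (reindex_onto input_state (fun o => o.1.1)) => [|o /is_inputP //].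
by apply: eq_bigl => x; rewrite is_input_state eqxx.
Qed.

Definition embed kappa : qstate R basis :=
  fun o => if is_input o then (kappa o.1.1)%:C else 0.

Lemma norm2_embed kappa : norm2 (embed kappa) = \sum_x kappa x ^+ 2.
Proof.
rewrite -(sum_input (fun o => kappa o.1.1 ^+ 2)) [RHS]big_mkcond.
apply: eq_bigr => o _; rewrite /embed; case: ifP => _; first exact: sqmod_real.
exact: sqmod0.
Qed.

Definition answer_sign o : R := if o.2 then 1 else -1.

Definition kickback (O : qop R basis) (v : qstate R basis) : qstate R basis :=
  apply (adjoint O) (fun o => (answer_sign o)%:C * apply O v o).

Definition off_input (O : qop R basis) kappa : qstate R basis :=
  fun o => if is_input o then 0 else kickback O (embed kappa) o.

(** The span of the vectors |x,0,0> and g_x is invariant under [kickback]; these are its elements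
    with real coordinates [kappa x] and [gamma x]. *)
Definition level_state (O : qop R basis) kappa gamma : qstate R basis :=
  fun o => embed kappa o + off_input O gamma o.

Variables (f : 'I_N -> bool) (O : qop R basis) (epsx : 'I_N -> R).
Hypothesis biasedO : biased_oracle f O epsx.

Definition signed_bias x : R := (if f x then 2 else -2) * epsx x.
Local Notation d := signed_bias.

Let unitO : unitary O. Proof. by case: biasedO. Qed.

Lemma answer_sign_isometry :
  linear_isometry (fun (v : qstate R basis) o => (answer_sign o)%:C * v o).
Proof.
split=> [a u v|u]; first by apply: funext => o; ring.
rewrite /norm2; apply: eq_bigr => o _; rewrite sqmodM sqmod_real /answer_sign.
by case: ifP => _; rewrite ?sqrrN expr1n mul1r.
Qed.

Lemma kickback_isometry : linear_isometry (kickback O).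
Proof.
have isoO := unitary_isometry unitO.
have isoO' := unitary_isometry (unitary_adjoint unitO).
exact: isometry_comp isoO' (isometry_comp answer_sign_isometry isoO).
Qed.

Lemma kickbackK : involutive (kickback O).
Proof.
move=> v; rewrite /kickback.
have OK u : apply O (apply (adjoint O) u) = u.
  by rewrite -{1}(adjointK O) adjoint_apply //; apply: unitary_adjoint.
rewrite OK; rewrite -[RHS](adjoint_apply v unitO); congr (apply _ _).
apply: funext => o; rewrite mulrA -rmorphM /= /answer_sign.
by case: ifP => _; rewrite ?mulrNN mulr1 mul1r.
Qed.

Lemma oracle_off_diagonal x o : o.1.1 != x -> O o (input_state x) = 0.
Proof.
case: biasedO => _ /(_ x) [al [be [w [w' [_ _ _ Ox]]]]].
case: o => [[y v] b] /= /negbTE nyx.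
by rewrite -apply_ket Ox nyx mul0r.
Qed.

(** [b] is |beta_x|^2. Leaving the weight [c] free yields both the column norm (constant weight 1)
    and the signed bias (weights 1 and -1). *)
Lemma oracle_answer_sum x : exists2 b : R, 0 <= b & forall c : bool -> R,
  \sum_o c o.2 * sqmod (O o (input_state x))
  = c (f x) * (2^-1 + epsx x) + c (~~ f x) * b.
Proof.
case: biasedO => _ /(_ x) [al [be [w [w' [Nw Nw' sq_al Ox]]]]].
exists (sqmod be) => [|c]; first exact: sqmod_ge0.
transitivity (\sum_y \sum_v \sum_b c b * sqmod (O (y, v, b) (input_state x))).
  rewrite pair_bigA pair_bigA /=.
  by apply: eq_bigr => -[[y v] b] _.
rewrite (bigD1 x) //= [X in _ + X]big1 ?addr0 => [|y nyx]; last first.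
  rewrite big1 // => v _; rewrite big1 // => b _.
  by rewrite oracle_off_diagonal // sqmod0 mulr0.
transitivity (\sum_v (c (f x) * sqmod al * sqmod (w v)
                      + c (~~ f x) * sqmod be * sqmod (w' v))).
  apply: eq_bigr => v _; rewrite big_bool /= -!apply_ket !Ox eqxx !mul1r.
  by case: (f x); rewrite !(mulr1, mulr0, addr0, add0r) !sqmodM; ring.
by rewrite big_split /= -!mulr_sumr -sq_al Nw Nw'; ring.
Qed.

Lemma oracle_column_norm x : \sum_o sqmod (O o (input_state x)) = 1.
Proof.
rewrite -[RHS](norm2_ket R (input_state x)) -(unitary_isometry unitO).2.
by apply: eq_bigr => o _; rewrite apply_ket.
Qed.

Lemma bias_le x : epsx x <= 2^-1.
Proof.
have [b b0 /(_ (fun=> 1))] := oracle_answer_sum x.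
by under eq_bigr do rewrite mul1r; rewrite oracle_column_norm; lra.
Qed.

Lemma oracle_answer_bias x :
  \sum_o answer_sign o * sqmod (O o (input_state x)) = d x.
Proof.
have [b b0 sumO] := oracle_answer_sum x.
have := sumO (fun=> 1); under eq_bigr do rewrite mul1r.
rewrite oracle_column_norm (sumO (fun b => if b then 1 else -1)) /signed_bias.
by case: (f x) => /=; lra.
Qed.

(** [O] keeps |x,0,0> inside the block of index x, so different inputs never interfere and
    [kickback] is diagonal between inputs. *)
Lemma kickback_embed kappa x :
  kickback O (embed kappa) (input_state x) = (d x * kappa x)%:C.
Proof.
rewrite -oracle_answer_bias mulr_suml rmorph_sum /kickback /apply.
apply: eq_bigr => o _ /=; rewrite /adjoint.
have -> : \sum_p O o p * embed kappa p = \sum_y O o (input_state y) * (kappa y)%:C.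
  rewrite -(sum_input (fun p => O o p * (kappa p.1.1)%:C)) [RHS]big_mkcond.
  by apply: eq_bigr => p _; rewrite /embed; case: ifP; rewrite ?mulr0.
have [ox|nox] := eqVneq o.1.1 x; last first.
  by rewrite oracle_off_diagonal // conjc0 !mul0r sqmod0 mulr0 mul0r.
rewrite (bigD1 x) //= big1 ?addr0 => [|y nyx].
  by rewrite !rmorphM /= sqmodE; ring.
by rewrite oracle_off_diagonal ?mul0r // ox eq_sym.
Qed.

Lemma kickback_embedE kappa o :
  kickback O (embed kappa) o = level_state O (fun x => d x * kappa x) kappa o.
Proof.
rewrite /level_state /off_input /embed; case: ifP => [|_]; last by rewrite add0r.
by move/is_inputP=> ->; rewrite kickback_embed addr0.
Qed.

Lemma off_inputD kappa gamma (a : R) o :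
  off_input O (fun x => a * kappa x + gamma x) o
  = a%:C * off_input O kappa o + off_input O gamma o.
Proof.
rewrite /off_input; case: ifP => _; first by rewrite mulr0 addr0.
rewrite -(isometryP kickback_isometry); congr (kickback O _ o).
apply: funext => p; rewrite /embed; case: ifP => _; last by rewrite mulr0 addr0.
by rewrite rmorphD rmorphM.
Qed.

Lemma off_input0 o : off_input O (fun=> 0) o = 0.
Proof.
rewrite /off_input; case: ifP => // _.
rewrite -[RHS](isometry0 kickback_isometry o); congr (kickback O _ o).
by apply: funext => p; rewrite /embed; case: ifP.
Qed.

Lemma off_inputZ kappa (a : R) o :
  off_input O (fun x => a * kappa x) o = a%:C * off_input O kappa o.
Proof.
rewrite -[RHS]addr0 -(off_input0 o) -off_inputD; congr (off_input O _ o).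
by apply: funext => x; rewrite addr0.
Qed.

Lemma level_stateZ (a : R) kappa gamma o :
  a%:C * level_state O kappa gamma o
  = level_state O (fun x => a * kappa x) (fun x => a * gamma x) o.
Proof.
rewrite /level_state off_inputZ mulrDr; congr (_ + _); rewrite /embed.
by case: ifP => _; rewrite ?mulr0 // rmorphM.
Qed.

Lemma level_state_input kappa gamma o :
  is_input o -> level_state O kappa gamma o = (kappa o.1.1)%:C.
Proof. by rewrite /level_state /embed /off_input => ->; rewrite addr0. Qed.

Lemma level_state_off kappa gamma o :
  ~~ is_input o -> level_state O kappa gamma o = off_input O gamma o.
Proof. by rewrite /level_state /embed => /negbTE->; rewrite add0r. Qed.

(** Write U for [kickback O]. From U|x> = d_x|x> + g_x and U^2 = 1 follows U g_x = |x> - d_x U|x> =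
    (1 - d_x^2)|x> - d_x g_x. *)
Lemma kickback_level_state kappa gamma o :
  kickback O (level_state O kappa gamma) o =
  level_state O (fun x => d x * kappa x + (1 - d x ^+ 2) * gamma x)
                (fun x => kappa x - d x * gamma x) o.
Proof.
have isoU := kickback_isometry.
rewrite /level_state isometryD // -/(level_state _ _ _).
have -> : off_input O gamma =
  (fun p => kickback O (embed gamma) p - embed (fun x => d x * gamma x) p).
  by apply: funext => p; rewrite kickback_embedE /level_state addrC addKr.
rewrite isometryB // kickbackK !kickback_embedE /level_state.
have -> : off_input O (fun x => kappa x - d x * gamma x) o
   = off_input O kappa o - off_input O (fun x => d x * gamma x) o.
  rewrite addrC -mulN1r -(rmorphN1 (real_complex R)) -off_inputD.
  by congr (off_input O _ o); apply: funext => x; ring.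
have -> : embed (fun x => d x * kappa x + (1 - d x ^+ 2) * gamma x) o =
  embed (fun x => d x * kappa x) o + (embed gamma o
    - embed (fun x => d x * (d x * gamma x)) o).
  rewrite /embed; case: ifP => _; last by rewrite subr0 addr0.
  by rewrite -rmorphB -rmorphD /=; congr (_%:C); ring.
ring.
Qed.

Lemma norm2_off_input gamma : norm2 (off_input O gamma) <= \sum_x gamma x ^+ 2.
Proof.
rewrite -norm2_embed -(kickback_isometry.2 (embed gamma)).
apply: ler_sum => o _; rewrite /off_input; case: ifP => // _.
by rewrite sqmod0 sqmod_ge0.
Qed.

(** The two summands have disjoint supports, and the second is a restriction of an isometric image
    of [embed gamma]. *)
Lemma norm2_level_state kappa gamma :
  norm2 (level_state O kappa gamma) <= \sum_x (kappa x ^+ 2 + gamma x ^+ 2).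
Proof.
rewrite big_split /= -norm2_embed.
apply: le_trans (lerD (lexx _) (norm2_off_input gamma)).
rewrite /norm2 -big_split; apply: ler_sum => o _ /=.
have [io|nio] := boolP (is_input o).
  by rewrite level_state_input // /embed io lerDl sqmod_ge0.
by rewrite level_state_off // lerDr sqmod_ge0.
Qed.

End PhaseKickback.

(** * The scattering chain *)

Section Chain.
Variable R : realType.
Implicit Types d : R.

(* The ports |y,0,0> join levels 2i+1 and 2i+2 (level 0 being the open end),
   all other basis states join levels 2i and 2i+1. *)
Definition input_port (j : nat) : nat := if odd j then j.+1 else j.-1.
Definition off_port (j : nat) : nat := if odd j then j.-1 else j.+1.

Lemma input_portK : involutive input_port.
Proof. by case=> [|j] //; rewrite /input_port /=; case oj: (odd j); rewrite /= oj. Qed.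

Lemma off_portK : involutive off_port.
Proof. by case=> [|j] //; rewrite /off_port /=; case oj: (odd j); rewrite /= ?oj. Qed.

(* Amplitudes of the decaying wave: [- ratio d] is the square of its decay rate
   per level, the sign comes from the phase (-1)^j of level [j].  [off_amp] is the
   coefficient of the unnormalized vector g_x, so that no division by |g_x| = 0
   occurs at |d| = 1. *)
Definition ratio d : R := (`|d| - 1) / (`|d| + 1).

Definition input_amp d (j : nat) : R :=
  if odd j then Num.sg d * ratio d ^+ j./2.+1 else ratio d ^+ j./2.

Definition off_amp d (j : nat) : R :=
  (if odd j then 1 else Num.sg d) * (`|d| + 1)^-1 * ratio d ^+ j./2.

Lemma parity_ind (P : nat -> Prop) :
  (forall i, P i.*2) -> (forall i, P i.*2.+1) -> forall j, P j.
Proof. by move=> Pe Po j; rewrite -[j]odd_double_half; case: odd; [apply: Po|apply: Pe]. Qed.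

Lemma input_amp0 d : input_amp d 0 = 1. Proof. by []. Qed.

Lemma input_amp_double d i : input_amp d i.*2 = ratio d ^+ i.
Proof. by rewrite /input_amp odd_double doubleK. Qed.

Lemma input_amp_doubleS d i : input_amp d i.*2.+1 = Num.sg d * ratio d ^+ i.+1.
Proof. by rewrite /input_amp /= odd_double uphalf_double. Qed.

Lemma off_amp_double d i :
  off_amp d i.*2 = Num.sg d * (`|d| + 1)^-1 * ratio d ^+ i.
Proof. by rewrite /off_amp odd_double doubleK. Qed.

Lemma off_amp_doubleS d i : off_amp d i.*2.+1 = (`|d| + 1)^-1 * ratio d ^+ i.
Proof. by rewrite /off_amp /= odd_double uphalf_double mul1r. Qed.

Definition chain_ampE :=
  (input_amp_double, input_amp_doubleS, off_amp_double, off_amp_doubleS).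

(** Stationarity along the input ports: the kicked coordinate at a level is the standing wave's
    value at the level joined to it. At the open end, d + (1 - d^2) sg d / (|d| + 1) = sg d is the
    exact reflection coefficient. *)
Lemma chain_input d j : d != 0 ->
  (-1) ^+ j * (d * input_amp d j + (1 - d ^+ 2) * off_amp d j)
  = if j == 0%N then Num.sg d else input_amp d (input_port j).
Proof.
move=> d0; elim/parity_ind: j => i; rewrite !chain_ampE /input_port -signr_odd.
  rewrite odd_double double_eq0 /=; case: i => [|i].
    rewrite /= !expr0; have [d_lt0|d_gt0|/eqP] := ltrgt0P d; last by rewrite (negbTE d0).
      by rewrite gtr0_sg //; field; lra.
    by rewrite ltr0_sg //; field; lra.
  rewrite ?doubleS /= input_amp_doubleS.
  have [d_lt0|d_gt0|/eqP] := ltrgt0P d; last by rewrite (negbTE d0).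
    by rewrite gtr0_sg //; field; lra.
  by rewrite ltr0_sg //; field; lra.
rewrite /= odd_double /= -doubleS input_amp_double expr1 !exprS /ratio.
have [d_lt0|d_gt0|/eqP] := ltrgt0P d; last by rewrite (negbTE d0).
  by rewrite gtr0_sg //; field; lra.
by rewrite ltr0_sg //; field; lra.
Qed.

Lemma chain_off d j : d != 0 ->
  (-1) ^+ j * (input_amp d j - d * off_amp d j) = off_amp d (off_port j).
Proof.
move=> d0; elim/parity_ind: j => i; rewrite !chain_ampE /off_port -signr_odd.
  rewrite odd_double /= off_amp_doubleS.
  have [d_lt0|d_gt0|/eqP] := ltrgt0P d; last by rewrite (negbTE d0).
    by rewrite gtr0_sg //; field; lra.
  by rewrite ltr0_sg //; field; lra.
rewrite /= odd_double /= off_amp_double expr1 exprS /ratio.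
have [d_lt0|d_gt0|/eqP] := ltrgt0P d; last by rewrite (negbTE d0).
  by rewrite gtr0_sg //; field; lra.
by rewrite ltr0_sg //; field; lra.
Qed.

(** [q] is a decay rate common to all inputs; it will be 1 - 2 eps. *)
Lemma ratio_sqr_le d (q : R) : `|d| <= 1 -> 1 - `|d| <= q -> ratio d ^+ 2 <= q.
Proof.
move=> d1 dq; apply: le_trans dq; have d0 := normr_ge0 d.
rewrite /ratio; set m := `|d| in d0 d1 *.
have -> : ((m - 1) / (m + 1)) ^+ 2 = (1 - m) * ((1 - m) / (m + 1) ^+ 2).
  by field; lra.
rewrite ler_piMr ?subr_ge0 // ler_pdivrMr ?mul1r ?exprn_gt0; nra.
Qed.

Lemma chain_amp_le d (q : R) j : `|d| <= 1 -> 1 - `|d| <= q ->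
  input_amp d j ^+ 2 + off_amp d j ^+ 2 <= 2 * q ^+ j./2.
Proof.
move=> d1 dq; have r2q := ratio_sqr_le d1 dq; have d0 := normr_ge0 d.
have r21 : ratio d ^+ 2 <= 1 by apply: ratio_sqr_le => //; lra.
have sg2 : Num.sg d ^+ 2 <= 1.
  by rewrite sqr_sg; case: (d != 0); rewrite ?lexx ?ler01.
have mu1 : ((`|d| + 1)^-1) ^+ 2 <= 1.
  by rewrite exprVn invf_le1 ?exprn_gt0 ?exprn_ege1; lra.
have rq i : (ratio d ^+ i) ^+ 2 <= q ^+ i.
  by rewrite exprAC; apply: lerXn2r; rewrite ?nnegrE ?sqr_ge0 ?(le_trans (sqr_ge0 _) r2q).
have s0 := sqr_ge0 (Num.sg d); have m0 := sqr_ge0 (`|d| + 1)^-1.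
have r0 i := sqr_ge0 (ratio d ^+ i).
rewrite mulr_natl mulr2n; elim/parity_ind: j => i; rewrite !chain_ampE.
  rewrite doubleK; apply: lerD; first exact: rq.
  rewrite 2!exprMn; apply: le_trans (rq i); rewrite ler_piMl // mulr_ile1 //.
rewrite /= uphalf_double; apply: lerD; rewrite exprMn.
  rewrite [ratio d ^+ i.+1]exprS [(ratio d * _) ^+ 2]exprMn mulrA; apply: le_trans (rq i); rewrite ler_piMl //.
  by rewrite mulr_ile1 // sqr_ge0.
by apply: le_trans (rq i); rewrite ler_piMl.
Qed.

(** This is the mismatch caused by cutting the chain after 2n levels. It equals (1 - sg d) times
    [ratio d ^+ n], and |1 - sg d| is at most 2. *)
Lemma chain_end_le d (q : R) n : `|d| <= 1 -> 1 - `|d| <= q -> (0 < n)%N ->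
  (input_amp d n.*2 - input_amp d n.*2.-1) ^+ 2 <= 4 * q ^+ n.
Proof.
case: n => // n d1 dq _; have r2q := ratio_sqr_le d1 dq.
rewrite {2}doubleS [_.+2.-1]/= !chain_ampE.
have rq : (ratio d ^+ n.+1) ^+ 2 <= q ^+ n.+1.
  by rewrite exprAC; apply: lerXn2r; rewrite ?nnegrE ?sqr_ge0 ?(le_trans (sqr_ge0 _) r2q).
have -> : ratio d ^+ n.+1 - Num.sg d * ratio d ^+ n.+1
  = (1 - Num.sg d) * ratio d ^+ n.+1 by ring.
rewrite exprMn; apply: ler_pM => //; rewrite ?sqr_ge0 //.
by case: (ltrgt0P d) => [/gtr0_sg->|/ltr0_sg->|->]; rewrite ?sgr0; lra.
Qed.

End Chain.

(** * The algorithm *)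

Section Algorithm.
Variables (R : realType) (N k a : nat).
Local Notation C := R[i].
Local Notation "x %:C" := (real_complex R x).
Local Notation basis := (ospace N k).
Local Notation space := (aspace N k a).
Implicit Types (s r : space) (o : basis).

Definition ancilla_index (r : qubits a) : nat := enum_rank r.
Definition ancilla_at (j : nat) : qubits a := nth (zeros a) (enum (qubits a)) j.

Lemma ancilla_indexK : cancel ancilla_index ancilla_at.
Proof. by move=> r; rewrite /ancilla_at nth_enum_rank. Qed.

Lemma ancilla_atK j : (j < 2 ^ a)%N -> ancilla_index (ancilla_at j) = j.
Proof.
move=> lt_j; have lt_j' : (j < #|{: qubits a}|)%N.
  by rewrite card_ffun card_bool card_ord.
rewrite /ancilla_index /ancilla_at.
have -> : nth (zeros a) (enum (qubits a)) j = enum_val (Ordinal lt_j').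
  by rewrite (enum_val_nth (zeros a)).
by rewrite enum_valK.
Qed.

Lemma unitary_query (O : qop R basis) dag : unitary O -> unitary (@query R N k a O dag).
Proof.
move=> unitO; have unitO' := unitary_adjoint unitO.
move=> [o r] [o' r']; rewrite /query /=.
rewrite -(pair_bigA _ (fun p q =>
   conjc ((if dag then adjoint O p o else O p o) * (q == r)%:R) *
   ((if dag then adjoint O p o' else O p o') * (q == r')%:R))) /=.
transitivity (\sum_p conjc (if dag then adjoint O p o else O p o)
   * (if dag then adjoint O p o' else O p o') * (r == r')%:R).
  apply: eq_bigr => p _.
  rewrite -(sum_delta_sym (fun q => _ * _ * (q == r')%:R) r).
  by apply: eq_bigr => q _; rewrite rmorphM /= conjc_nat [q == r]eq_sym; ring.
rewrite -mulr_suml xpair_eqE -mulnb natrM; congr (_ * _).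
by case: dag; [exact: unitO'|exact: unitO].
Qed.

Lemma apply_query (O : qop R basis) dag v s :
  apply (@query R N k a O dag) v s
  = apply (if dag then adjoint O else O) (fun o => v (o, s.2)) s.1.
Proof.
case: s => o r; rewrite /apply /query /=.
transitivity (\sum_p \sum_q
    (r == q)%:R * ((if dag then adjoint O else O) o p * v (p, q))).
  by rewrite pair_bigA; apply: eq_bigr => -[p q] _ /=; case: dag; ring.
by apply: eq_bigr => p _; apply: sum_delta_sym.
Qed.

(* Ancilla indices: j < 2n are the chain levels, 2n + t the active flags (t < K),
   2n + K + t the idle ones, and 2n + 2K the initial state [home]. *)
Variables (x0 : 'I_N) (n K : nat) (al be : R).
Local Notation L := n.*2.

Definition port o j := if is_input o then input_port j else off_port j.

Lemma portK o : involutive (port o).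
Proof. by move=> j; rewrite /port; case: is_input; [exact: input_portK|exact: off_portK]. Qed.

(** Levels are swapped only when both lie in the chain; at the cut end a state stays on its level,
    and flags never move. *)
Definition route_index o j :=
  if (j < L)%N && (port o j < L)%N then port o j else j.

Lemma route_indexK o : involutive (route_index o).
Proof.
move=> j; rewrite /route_index; case lj: ((j < L) && (port o j < L))%N; last by rewrite lj.
by case/andP: lj => lj lp; rewrite portK lj lp.
Qed.

Definition route s : space := (s.1, ancilla_at (route_index s.1 (ancilla_index s.2))).

(** The phase is 1 outside the chain, so there the query and its inverse cancel. *)
Definition level_phase s : C :=
  if (ancilla_index s.2 < L)%N
  then (-1) ^+ ancilla_index s.2 * (answer_sign R s.1)%:C else 1.

Definition start s (j : nat) : bool :=
  (s.1 == input_state k x0) && (ancilla_index s.2 == j).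

Definition vertex (t : nat) s : R :=
  (start s (L + t))%:R - al * (is_input s.1 && (ancilla_index s.2 == 0%N))%:R.

Definition home : space := (input_state k x0, ancilla_at (L + K.*2)).

Definition uniform s : R :=
  ((s.1 == input_state k x0) && (L <= ancilla_index s.2 < L + K.*2)%N)%:R.

(** For be = (2K)^(-1/2), [home] and [be * uniform] are orthogonal unit vectors, and the reflection
    along their difference swaps them. The same operator thus prepares the flags and finally reads
    out the overlap with their superposition. *)
Definition prepare : qop R space :=
  refl_op (fun s => (s == home)%:R - be * uniform s).

Fixpoint rounds (t : nat) : seq (bool * qop R space) :=
  if t is t'.+1 then rounds t' ++
    [:: (false, diag_op level_phase); (true, opmul (refl_op (vertex t')) (perm_op R route))]
  else [::].

(* The idle query before the last one only turns O^dagger into the identity, as a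
   unitary must be preceded by a query. *)
Definition or_algorithm : algorithm R N k a :=
  Algorithm home prepare
    (rounds K ++ [:: (false, diag_op (fun=> 1)); (true, prepare)])
    (fun s => s == home).

Lemma size_rounds t : size (rounds t) = t.*2.
Proof. by elim: t => //= t IH; rewrite size_cat IH /= addn2 doubleS. Qed.

Lemma queries_or_algorithm : queries or_algorithm = K.+1.*2.
Proof. by rewrite /queries /= size_cat size_rounds addn2 doubleS. Qed.

Hypothesis room : (L + K.*2 < 2 ^ a)%N.

Lemma ancilla_atK_le j : (j <= L + K.*2)%N -> ancilla_index (ancilla_at j) = j.
Proof. by move=> lj; rewrite ancilla_atK // (leq_ltn_trans lj). Qed.

Lemma route_index_bound o j : (j < L)%N -> (route_index o j < L)%N.
Proof. by rewrite /route_index; case: ifP => // /andP[]. Qed.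

Lemma route_index_out o j : (L <= j)%N -> route_index o j = j.
Proof. by rewrite /route_index ltnNge => ->. Qed.

Lemma ancilla_index_route s :
  ancilla_index (route s).2 = route_index s.1 (ancilla_index s.2).
Proof.
rewrite /route /=; have [lt_j|ge_j] := ltnP (ancilla_index s.2) L.
  rewrite ancilla_atK_le // (leq_trans (ltnW (route_index_bound _ lt_j))) //.
  exact: leq_addr.
by rewrite route_index_out // ancilla_indexK.
Qed.

Lemma routeK : involutive route.
Proof.
case=> o r; rewrite {1}/route ancilla_index_route /= route_indexK.
by rewrite ancilla_indexK.
Qed.

Lemma level_phase_unit s : conjc (level_phase s) * level_phase s = 1.
Proof.
rewrite /level_phase; case: ifP => _; last by rewrite conjc1 mulr1.
rewrite -sqmodE sqmodM -(rmorphN1 (real_complex R)) -rmorphXn !sqmod_real.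
by rewrite sqrr_sign /answer_sign; case: ifP => _; rewrite ?sqrrN expr1n mulr1.
Qed.

Lemma nth_rounds_unitary p t i :
  unitary p.2 -> (i < t.*2)%N -> unitary (nth p (rounds t) i).2.
Proof.
move=> unitp; elim: t => //= t IH.
rewrite nth_cat size_rounds => lt_i; case: ltnP => [|le_i]; first exact: IH.
case: (i - t.*2)%N => [|[|j]] /=; last by rewrite nth_nil.
  exact/unitary_diag/level_phase_unit.
exact: unitary_opmul (unitary_refl _) (unitary_perm _ routeK).
Qed.

Lemma or_algorithm_valid : valid_algorithm or_algorithm.
Proof.
split=> [|i]; first exact: unitary_refl.
rewrite /= size_cat size_rounds nth_cat size_rounds => lt_i.
case: ltnP => [|le_i].
  by apply: nth_rounds_unitary; apply: unitary_refl.
case: (i - K.*2)%N => [|[|j]] /=; [|exact: unitary_refl|].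
  exact: unitary_one.
by rewrite nth_nil; apply: unitary_refl.
Qed.

(** * Action of the rounds under a given biased oracle *)

Section Run.
Variables (f : 'I_N -> bool) (O : qop R basis) (epsx : 'I_N -> R).
Hypothesis biasedO : biased_oracle f O epsx.
Local Notation d := (signed_bias f epsx).

Let unitO : unitary O. Proof. by case: biasedO. Qed.

Definition round (t : nat) (v : qstate R space) : qstate R space :=
  apply (opmul (refl_op (vertex t)) (perm_op R route)) (apply (@query R N k a O true)
    (apply (diag_op level_phase) (apply (@query R N k a O false) v))).

Lemma round_isometry t : linear_isometry (round t).
Proof.
have unitR := unitary_opmul (unitary_refl (vertex t)) (unitary_perm R routeK).
have unitQ b := unitary_query b unitO.
have unitP := unitary_diag level_phase_unit.
exact: isometry_comp (unitary_isometry unitR) (isometry_comp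
  (unitary_isometry (unitQ true)) (isometry_comp (unitary_isometry unitP)
  (unitary_isometry (unitQ false)))).
Qed.

Lemma final_stateE : final_state or_algorithm O
  = apply prepare (foldl (fun v t => round t v) (apply prepare (ket R home)) (iota 0 K)).
Proof.
rewrite /final_state /= foldl_cat /= apply_one; congr (apply _ _).
rewrite -[RHS]apply_one; set v := foldl _ _ (rounds K); set w := foldl _ _ _.
have <- : v = w.
  rewrite /v /w; elim: K => // t IH; rewrite -[in iota _ _]addn1 iotaD !foldl_cat /=.
  by rewrite -IH.
rewrite apply_one; apply: funext => -[o r]; rewrite !apply_query /=.
have -> : (fun o0 => apply (@query R N k a O false) v (o0, r)) = apply O (fun o0 => v (o0, r)).
  by apply: funext => p; rewrite apply_query.
by rewrite adjoint_apply.
Qed.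

Lemma kicked_round v s :
  apply (@query R N k a O true)
    (apply (diag_op level_phase) (apply (@query R N k a O false) v)) s
  = if (ancilla_index s.2 < L)%N
    then (-1) ^+ ancilla_index s.2 * kickback O (fun o => v (o, s.2)) s.1 else v s.
Proof.
case: s => o r; rewrite apply_query /=.
have -> : (fun p => apply (diag_op level_phase) (apply (@query R N k a O false) v) (p, r))
  = (fun p => level_phase (p, r) * apply O (fun p => v (p, r)) p).
  by apply: funext => p; rewrite apply_diag apply_query.
rewrite /level_phase /=; case: ifP => _; last first.
  under [X in apply _ X]funext => p do rewrite mul1r.
  by rewrite adjoint_apply.
rewrite /kickback -(isometryZ (unitary_isometry (unitary_adjoint unitO))).
by congr (apply _ _ o); apply: funext => p; rewrite mulrA.
Qed.

Variables (kappa : 'I_N -> R) (theta : R).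

Definition chain_level (j : nat) : qstate R basis :=
  level_state O (fun x => kappa x * input_amp (d x) j)
                (fun x => kappa x * off_amp (d x) j).

(** The first [t] flags have met their round and carry 1 - theta; the later active flags and the
    idle ones still carry 1. *)
Definition flag_amp (t j : nat) : R :=
  if (j < L + t)%N then 1 - theta else if (j < L + K.*2)%N then 1 else 0.

Definition run_state (t : nat) : qstate R space := fun s =>
  if (ancilla_index s.2 < L)%N then chain_level (ancilla_index s.2) s.1
  else (s.1 == input_state k x0)%:R * (flag_amp t (ancilla_index s.2))%:C.

(** The defect of stationarity at the cut end: the input port of level L - 1 leads to the absent
    level L. *)
Definition truncation : qstate R space := fun s =>
  if is_input s.1 && (ancilla_index s.2 == L.-1)
  then (kappa s.1.1.1 * (input_amp (d s.1.1.1) L - input_amp (d s.1.1.1) L.-1))%:C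
  else 0.

Hypothesis n_gt0 : (0 < n)%N.
Hypothesis d_neq0 : forall x, d x != 0.
(** Scattering at the joint. [theta] is the coefficient 2<w,v>/<w,w> with which the reflection along
    the vertex w subtracts w from the routed state v; [reflectE] says that this restores [kappa] at
    level 0. *)
Hypothesis thetaE :
  theta = 2 * (1 - al * \sum_x kappa x * Num.sg (d x)) / (1 + al ^+ 2 * N%:R).
Hypothesis reflectE : forall x, kappa x * Num.sg (d x) + theta * al = kappa x.

Lemma kicked_chain j o :
  (-1) ^+ j * kickback O (chain_level j) o =
  level_state O
    (fun x => kappa x * if j == 0%N then Num.sg (d x) else input_amp (d x) (input_port j))
    (fun x => kappa x * off_amp (d x) (off_port j)) o.
Proof.
rewrite (kickback_level_state biasedO) -(rmorphN1 (real_complex R)) -rmorphXn.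
rewrite (level_stateZ biasedO); congr (level_state O _ _ o); apply: funext => x.
  by rewrite -chain_input //; ring.
by rewrite -chain_off //; ring.
Qed.

Lemma L_gt1 : (1 < L)%N. Proof. by case: n n_gt0. Qed.

(* The chain reflects |x,0,0> with coefficient sg d_x instead of 1. *)
Definition bounce : qstate R space := fun s =>
  if is_input s.1 && (ancilla_index s.2 == 0%N)
  then (kappa s.1.1.1 * (Num.sg (d s.1.1.1) - 1))%:C else 0.

Lemma routed_round t s :
  apply (perm_op R route) (apply (@query R N k a O true)
    (apply (diag_op level_phase) (apply (@query R N k a O false) (run_state t)))) s
  = run_state t s + bounce s + truncation s.
Proof.
have L1 := L_gt1.
rewrite apply_perm kicked_round /run_state /bounce /truncation.
rewrite !ancilla_index_route [(route s).1]/=.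
set j := ancilla_index s.2; set o := s.1.
have [lt_j|ge_j] := ltnP j L; last first.
  rewrite route_index_out // ltnNge ge_j /=.
  have -> : (j == 0%N) = false by lia.
  have -> : (j == L.-1) = false by lia.
  by rewrite !andbF !addr0.
rewrite route_index_bound //.
rewrite [X in kickback O X](_ : _ = chain_level (route_index o j)); last first.
  exact: funext.
rewrite kicked_chain /route_index lt_j /= /port.
have [io|nio] := boolP (is_input o); last first.
  (* [L] is even, so no pair 2i, 2i+1 straddles the cut. *)
  have -> : (off_port j < L)%N.
    move: lt_j; elim/parity_ind: (j) => i; rewrite /off_port /= odd_double /=; lia.
  by rewrite /chain_level /= !addr0 !level_state_off // off_portK.
rewrite !level_state_input // /chain_level level_state_input //.
have [lt_p|ge_p] := ltnP (input_port j) L.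
  have -> : (j == L.-1) = false.
    apply/negbTE/eqP => jL; move: lt_p.
    have : odd j by rewrite jL; case: n n_gt0 => //= m _; rewrite odd_double.
    by rewrite /input_port => ->; lia.
  rewrite addr0 input_portK.
  have [->|j0] := eqVneq j 0%N.
    by rewrite /= input_amp0 -rmorphD; congr (_%:C); ring.
  have -> : (input_port j == 0%N) = false by rewrite /input_port; case: ifP; lia.
  by rewrite addr0.
have jL : j = L.-1 by move: ge_p; rewrite /input_port; case: ifP; lia.
have odd_j : odd j by rewrite jL; case: n n_gt0 => //= m _; rewrite odd_double.
have -> : (j == 0%N) = false by lia.
rewrite -jL eqxx addr0 /input_port odd_j -rmorphD.
have -> : j.+1 = L by lia.
by congr (_%:C); ring.
Qed.

Lemma sum_input_at (V : nmodType) (F : space -> V) j : (j <= L + K.*2)%N ->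
  \sum_(s | is_input s.1 && (ancilla_index s.2 == j)) F s
  = \sum_x F (input_state k x, ancilla_at j).
Proof.
move=> le_j; rewrite (reindex_onto (fun x => (input_state k x, ancilla_at j))
  (fun s => s.1.1.1)) /=; last first.
  by case=> o r /andP[/= /is_inputP-> /eqP<-]; rewrite ancilla_indexK.
by apply: eq_bigl => x; rewrite is_input_state ancilla_atK_le // !eqxx.
Qed.

Lemma sum_start (V : nmodType) (F : space -> V) j : (j <= L + K.*2)%N ->
  \sum_(s | start s j) F s = F (input_state k x0, ancilla_at j).
Proof.
move=> le_j; rewrite (big_pred1 (input_state k x0, ancilla_at j)) // => -[o r].
rewrite /start /= xpair_eqE; congr (_ && _).
by apply/eqP/eqP => [<-|->]; rewrite ?ancilla_indexK ?ancilla_atK_le.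
Qed.

Lemma vertex_dot t (v : qstate R space) : (t < K)%N ->
  \sum_s (vertex t s)%:C * v s = v (input_state k x0, ancilla_at (L + t))
    - al%:C * \sum_x v (input_state k x, ancilla_at 0).
Proof.
move=> tK; rewrite -(sum_start v) -?(sum_input_at v) //; last by lia.
rewrite mulr_sumr [X in X - _]big_mkcond [X in _ - X]big_mkcond -sumrB.
apply: eq_bigr => s _; rewrite /vertex rmorphB rmorphM !rmorph_nat mulrBl.
congr (_ - _).
  by case: (start s _); rewrite ?mul1r ?mul0r.
by case: (is_input _ && _); rewrite ?mulr1 ?mulr0 ?mul0r.
Qed.

Lemma start_vertex t : (t < K)%N ->
  vertex t (input_state k x0, ancilla_at (L + t)) = 1.
Proof.
move=> tK; have L1 := L_gt1; rewrite /vertex /start /= ancilla_atK_le; last by lia.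
rewrite !eqxx /=; have -> : (L + t == 0)%N = false by lia.
by rewrite andbF mulr0 subr0.
Qed.

Lemma input_vertex t x : (t < K)%N -> vertex t (input_state k x, ancilla_at 0) = - al.
Proof.
move=> tK; have L1 := L_gt1; rewrite /vertex /start /= ancilla_atK_le //.
rewrite is_input_state; have -> : (0 == L + t)%N = false by lia.
by rewrite andbF mulr1 sub0r.
Qed.

Lemma norm_vertex t : (t < K)%N ->
  \sum_s vertex t s ^+ 2 = 1 + al ^+ 2 * N%:R.
Proof.
move=> tK; apply: complexI; rewrite rmorph_sum.
under eq_bigr => s _ do rewrite rmorphXn /= expr2.
rewrite vertex_dot // start_vertex //.
under eq_bigr => x _ do rewrite input_vertex //.
rewrite sumr_const card_ord -rmorphMn -rmorphM -rmorphB; congr (_%:C).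
by rewrite -mulr_natr; ring.
Qed.

(** Subtracting [theta * vertex t] turns flag [t] from 1 into 1 - theta and cancels [bounce] at
    level 0. As L - 1 > 0, [truncation] is orthogonal to the vertex and passes through unchanged. *)
Lemma round_run_state t s : (t < K)%N ->
  round t (run_state t) s = run_state t.+1 s + truncation s.
Proof.
move=> tK; have L1 := L_gt1; rewrite /round apply_opmul apply_refl norm_vertex //.
under [X in _ - _ * X]eq_bigr => r _ do rewrite routed_round.
rewrite routed_round vertex_dot //.
have -> : run_state t (input_state k x0, ancilla_at (L + t)) +
   bounce (input_state k x0, ancilla_at (L + t)) +
   truncation (input_state k x0, ancilla_at (L + t)) = 1.
  rewrite /run_state /bounce /truncation /= !ancilla_atK_le; try by lia.
  have -> : (L + t < L)%N = false by lia.
  have -> : (L + t == 0)%N = false by lia.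
  have -> : (L + t == L.-1)%N = false by lia.
  rewrite !andbF !addr0 eqxx mul1r /flag_amp ltnn.
  by have -> : (L + t < L + K.*2)%N by lia.
have -> : \sum_x (run_state t (input_state k x, ancilla_at 0) +
   bounce (input_state k x, ancilla_at 0) +
   truncation (input_state k x, ancilla_at 0))
   = (\sum_x kappa x * Num.sg (d x))%:C.
  rewrite rmorph_sum; apply: eq_bigr => x _.
  rewrite /run_state /bounce /truncation /= !ancilla_atK_le //.
  have -> : (0 < L)%N by lia.
  have -> : (0 == L.-1)%N = false by lia.
  rewrite is_input_state /= addr0 /chain_level level_state_input ?is_input_state //=.
  by rewrite input_amp0 -rmorphD; congr (_%:C); ring.
rewrite -[1 - _ * _]/(1%:C - _) -!rmorphM -rmorphB -rmorphM.
have -> : 2 / (1 + al ^+ 2 * N%:R) * vertex t s *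
  (1 - al * \sum_x kappa x * Num.sg (d x)) = theta * vertex t s.
  by rewrite thetaE; ring.
rewrite addrAC; congr (_ + _).
rewrite /run_state /bounce /vertex /start; case: s => o r /=.
set j := ancilla_index r.
have [lt_j|ge_j] := ltnP j L.
  have -> : (j == L + t)%N = false by lia.
  rewrite andbF sub0r; have [/andP[io /eqP j0]|_] := boolP (is_input o && _).
    rewrite j0 /chain_level level_state_input // input_amp0 -rmorphD -rmorphB.
    by congr (_%:C); have := reflectE o.1.1; rewrite mulr1n; lra.
  by rewrite mulr0 oppr0 mulr0 addr0 subr0.
have -> : (j == 0)%N = false by lia.
rewrite !andbF mulr0 addr0 subr0.
have [_|] := eqVneq o (input_state k x0); last by rewrite !mul0r mulr0 subr0.
rewrite !mul1r /= -rmorphB; congr (_%:C); rewrite /flag_amp.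
have [->|jt] := eqVneq j (L + t)%N.
  rewrite ltnn mulr1; have -> : (L + t < L + K.*2)%N by lia.
  by have -> : (L + t < L + t.+1)%N by lia.
rewrite mulr0 subr0.
by have -> : (j < L + t.+1)%N = (j < L + t)%N by lia.
Qed.

(** * Norms of the truncation error and of the catalyst *)

Lemma norm2_truncation (q : R) :
  (forall x, `|d x| <= 1) -> (forall x, 1 - `|d x| <= q) ->
  norm2 truncation <= 4 * q ^+ n * \sum_x kappa x ^+ 2.
Proof.
move=> d1 dq; have -> : norm2 truncation
  = \sum_x (kappa x * (input_amp (d x) L - input_amp (d x) L.-1)) ^+ 2.
  rewrite -(sum_input_at (fun s => (kappa s.1.1.1 *
    (input_amp (d s.1.1.1) L - input_amp (d s.1.1.1) L.-1)) ^+ 2)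
    (j := L.-1)); last by lia.
  rewrite [RHS]big_mkcond; apply: eq_bigr => s _; rewrite /truncation.
  by case: ifP => _; [exact: sqmod_real|exact: sqmod0].
rewrite mulr_sumr; apply: ler_sum => x _; rewrite exprMn mulrC.
by apply: ler_wpM2r; [exact: sqr_ge0|exact: chain_end_le].
Qed.

Definition catalyst : qstate R space := fun s =>
  if (ancilla_index s.2 < L)%N then chain_level (ancilla_index s.2) s.1 else 0.

Lemma norm2_catalystE : norm2 catalyst = \sum_(j < L) norm2 (chain_level j).
Proof.
have le_L : (L <= #|{: qubits a}|)%N by rewrite card_ffun card_bool card_ord; lia.
rewrite (big_ord_widen _ (fun j => norm2 (chain_level j)) le_L) big_mkcond.
rewrite (reindex _ (onW_bij _ (@enum_rank_bij _))) /=.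
transitivity (\sum_r \sum_o sqmod (catalyst (o, r))).
  by rewrite exchange_big pair_bigA; apply: eq_bigr => -[].
apply: eq_bigr => r _; rewrite /catalyst /= -/(ancilla_index r).
by case: ifP => // _; rewrite big1 // => o _; rewrite sqmod0.
Qed.

(** Each power of [q] bounds two consecutive levels, giving a geometric series. Multiplying by 1 - q
    instead of dividing includes [q = 1]. *)
Lemma norm2_catalyst (q : R) :
  (forall x, `|d x| <= 1) -> (forall x, 1 - `|d x| <= q) -> 0 <= q <= 1 ->
  (1 - q) * norm2 catalyst <= 4 * \sum_x kappa x ^+ 2.
Proof.
move=> d1 dq /andP[q0 q1]; set S2 := \sum_x _.
have S0 : 0 <= S2 by apply: sumr_ge0 => x _; apply: sqr_ge0.
have le_level j : norm2 (chain_level j) <= 2 * q ^+ j./2 * S2.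
  apply: le_trans (norm2_level_state biasedO _ _) _.
  rewrite mulr_sumr; apply: ler_sum => x _; rewrite 2!exprMn -mulrDr mulrC.
  by apply: ler_wpM2r; [exact: sqr_ge0|exact: chain_amp_le].
have geo m : (1 - q) * \sum_(j < m.*2) q ^+ j./2 = 2 * (1 - q ^+ m).
  elim: m => [|m IH]; first by rewrite big_ord0 expr0 subrr !mulr0.
  rewrite doubleS !big_ord_recr /= !mulrDr IH uphalf_double doubleK exprS; ring.
rewrite norm2_catalystE; apply: le_trans (_ : (1 - q) *
  \sum_(j < L) 2 * q ^+ j./2 * S2 <= _).
  by rewrite ler_wpM2l ?subr_ge0 //; apply: ler_sum => j _; apply: le_level.
rewrite -mulr_suml -mulr_sumr mulrA [_ * (2 * _)]mulrCA geo.
by rewrite ler_wpM2r //; have := exprn_ge0 n q0; lra.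
Qed.

(** * Preparation of the flags and the final amplitude *)

Lemma run_state0 s : run_state 0 s = (uniform s)%:C + catalyst s.
Proof.
rewrite /run_state /catalyst /uniform /flag_amp addn0.
case: ltnP => [lt_j|ge_j] /=; first by rewrite andbF rmorph0 add0r.
rewrite addr0; case: eqP => _; rewrite /= ?mul1r ?mul0r ?rmorph0 //.
by case: ltnP => _; rewrite ?rmorph1 ?rmorph0.
Qed.

Lemma uniformE s : uniform s = \sum_(i < K.*2) (start s (L + i))%:R.
Proof.
rewrite /uniform /start; case: eqP => _ /=; last by rewrite big1.
set j := ancilla_index s.2; have [/andP[le_j lt_j]|out_j] := boolP (_ && _).
  have lt_i : (j - L < K.*2)%N by lia.
  rewrite (bigD1 (Ordinal lt_i)) //= subnKC // eqxx big1 ?addr0 // => i ne_i.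
  case: eqP => // j_eq; case/eqP: ne_i; apply: val_inj => /=; lia.
rewrite big1 // => i _; case: eqP => // j_eq; case/negP: out_j.
by rewrite j_eq; have := ltn_ord i; lia.
Qed.

Lemma uniform_dot (v : qstate R space) :
  \sum_s (uniform s)%:C * v s
  = \sum_(i < K.*2) v (input_state k x0, ancilla_at (L + i)).
Proof.
transitivity (\sum_s \sum_(i < K.*2) (start s (L + i))%:R * v s).
  apply: eq_bigr => s _; rewrite uniformE rmorph_sum mulr_suml.
  by apply: eq_bigr => i _; rewrite rmorph_nat.
rewrite exchange_big; apply: eq_bigr => i _ /=; rewrite -sum_start.
  rewrite [RHS]big_mkcond; apply: eq_bigr => s _.
  by case: start; rewrite ?mul1r ?mul0r.
by have := ltn_ord i; lia.
Qed.

Lemma uniform_home : uniform home = 0.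
Proof. by rewrite /uniform /home /= ancilla_atK_le // ltnn !andbF. Qed.

Hypothesis be_norm : be ^+ 2 * (K.*2)%:R = 1.

Lemma sum_uniform : \sum_s uniform s = (K.*2)%:R.
Proof.
apply: complexI; rewrite rmorph_sum rmorph_nat.
transitivity (\sum_s (uniform s)%:C * (fun=> 1) s).
  by apply: eq_bigr => s _; rewrite mulr1.
by rewrite uniform_dot sumr_const card_ord.
Qed.

Lemma prepare_norm : \sum_s ((s == home)%:R - be * uniform s) ^+ 2 = 2.
Proof.
transitivity (\sum_s (s == home)%:R + be ^+ 2 * \sum_s uniform s : R).
  rewrite mulr_sumr -big_split; apply: eq_bigr => s _ /=.
  have [->|_] := eqVneq s home; first by rewrite uniform_home mulr1n; ring.
  by rewrite /uniform; case: (_ && _); rewrite ?mulr1n ?mulr0n; ring.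
rewrite sum_uniform be_norm (bigD1 home) //= eqxx big1 ?addr0 //.
by move=> s /negbTE->.
Qed.

Lemma prepare_home v : apply prepare v home = be%:C * \sum_s (uniform s)%:C * v s.
Proof.
rewrite apply_refl prepare_norm eqxx uniform_home mulr0 subr0 mulr1 divff ?pnatr_eq0 //.
rewrite mul1r; under eq_bigr => s _ do rewrite rmorphB rmorph_nat rmorphM mulrBl -mulrA.
by rewrite sumrB sum_delta -mulr_sumr subKr.
Qed.

Lemma prepare_ket : apply prepare (ket R home) = fun s => be%:C * (uniform s)%:C.
Proof.
apply: funext => s; rewrite apply_refl prepare_norm divff ?pnatr_eq0 // mul1r.
rewrite (eq_bigr (fun t => (t == home)%:R * ((t == home)%:R - be * uniform t)%:C)).
  rewrite sum_delta eqxx uniform_home mulr0 subr0 mulr1 /ket rmorphB rmorph_nat.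
  by rewrite rmorphM subKr.
by move=> t _; rewrite /ket mulrC.
Qed.

Lemma run_isometry t :
  linear_isometry (fun v => foldl (fun v t => round t v) v (iota 0 t)).
Proof.
elim: t => [|t IH]; first exact: isometry_id.
rewrite -[t.+1]addn1 iotaD; under [X in linear_isometry X]funext do rewrite foldl_cat.
exact: isometry_comp (round_isometry t) IH.
Qed.

(** The prepared state is [be] times [run_state 0 - catalyst]. Since the whole run is a linear
    isometry, the missing catalyst costs at most [be * c] and the K truncations at most
    [be * K * eta]. *)
Lemma final_amplitude (eta c : R) :
  0 <= be -> 0 <= eta -> 0 <= c -> norm2 truncation <= eta ^+ 2 ->
  norm2 catalyst <= c ^+ 2 ->
  `|final_state or_algorithm O home - (1 - theta / 2)%:C|
    <= (be * (K%:R * eta + c))%:C.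
Proof.
move=> be0 eta0 c0 le_eta le_c.
have isoV := unitary_isometry (unitary_refl (fun s => (s == home)%:R - be * uniform s)).
rewrite -/prepare in isoV.
pose F v := foldl (fun v t => round t v) v (iota 0 K).
have isoVF := isometry_comp isoV (run_isometry K).
have runE : (fun s => run_state 0 s - catalyst s) = (fun s => (uniform s)%:C).
  by apply: funext => s; rewrite run_state0 addrK.
have -> : final_state or_algorithm O home
  = be%:C * (apply prepare (F (run_state 0)) home - apply prepare (F catalyst) home).
  rewrite final_stateE prepare_ket.
  rewrite -[apply _ (F _) home - _](isometryB isoVF) runE.
  exact: (isometryZ isoVF).
(* K flags at 1 - theta and K idle ones at 1 average to 1 - theta / 2: the idle flags turn the sign
   of the active ones into an amplitude 1 or 0. *)
have VrunK : be%:C * apply prepare (run_state K) home = (1 - theta / 2)%:C.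
  rewrite prepare_home uniform_dot mulrA -rmorphM.
  have -> : \sum_(i < K.*2) run_state K (input_state k x0, ancilla_at (L + i))
    = (K%:R * (1 - theta) + K%:R)%:C.
    rewrite -addnn big_split_ord /= rmorphD; congr (_ + _).
      rewrite (eq_bigr (fun=> (1 - theta)%:C)) => [|i _].
        by rewrite sumr_const card_ord rmorphM rmorph_nat mulr_natl.
      have lt_i := ltn_ord i; rewrite /run_state /= ancilla_atK_le; last by lia.
      have -> : (L + i < L)%N = false by lia.
      by rewrite eqxx mul1r /flag_amp ltn_add2l lt_i.
    rewrite (eq_bigr (fun=> 1)) => [|i _].
      by rewrite sumr_const card_ord rmorph_nat.
    have lt_i := ltn_ord i; rewrite /run_state /= ancilla_atK_le; last by lia.
    have -> : (L + (K + i) < L)%N = false by lia.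
    rewrite eqxx mul1r /flag_amp; have -> : (L + (K + i) < L + K)%N = false by lia.
    by have -> : (L + (K + i) < L + K.*2)%N by lia.
  rewrite -rmorphM; congr (_%:C).
  have := be_norm; rewrite -addnn natrD => be_norm'.
  transitivity (be ^+ 2 * (K%:R + K%:R) * (1 - theta / 2)); first by field.
  by rewrite be_norm' mul1r.
rewrite -VrunK -mulrBr normrM.
have -> : `|be%:C| = be%:C by rewrite ger0_norm // ler0c.
rewrite [(be * _)%:C]rmorphM ler_wpM2l ?ler0c // rmorphD.
have le_cat := isometry_le_norm isoVF home c0 le_c.
have le_run := telescope_isometry home (fun t _ => round_isometry t)
  (fun t r tK => round_run_state r tK) eta0 (fun t _ => le_eta) isoV.
rewrite addrAC; apply: le_trans (ler_normB _ _) _.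
exact: lerD.
Qed.

Lemma final_norm : norm2 (final_state or_algorithm O) = 1.
Proof.
have isoV := unitary_isometry (unitary_refl (fun s => (s == home)%:R - be * uniform s)).
by rewrite final_stateE isoV.2 (run_isometry K).2 isoV.2 norm2_ket.
Qed.

(** An amplitude within 1/6 of 1 has probability at least 25/36, and one within 1/6 of 0 at most
    1/36. *)
Lemma prob_output_ge (b : bool) (e : R) :
  1 - theta / 2 = b%:R -> 0 <= e <= 6^-1 ->
  `|final_state or_algorithm O home - (1 - theta / 2)%:C| <= e%:C ->
  2 / 3 <= prob_output or_algorithm O b.
Proof.
move=> -> /andP[e0 e6] le_e.
have {le_e} : sqmod (final_state or_algorithm O home - b%:R%:C) <= e ^+ 2.
  rewrite -lecR sqmod_norm rmorphXn.
  by rewrite ler_pXn2r ?nnegrE ?normr_ge0 ?ler0c.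
have e2 : e ^+ 2 <= 36^-1 by nra.
move=> /le_trans/(_ e2).
have prob_true : prob_output or_algorithm O true
    = sqmod (final_state or_algorithm O home).
  rewrite /prob_output /= (big_pred1 home) // => s; by rewrite eqb_id.
have prob_false : prob_output or_algorithm O false
    = 1 - sqmod (final_state or_algorithm O home).
  rewrite -final_norm /norm2 (bigD1 home) //= addrC addrK.
  by apply: eq_bigl => s; rewrite eqbF_neg.
case: b; rewrite ?prob_true ?prob_false.
  case: (final_state _ _ _) => p r; rewrite /sqmod /= subr0; nra.
by rewrite rmorph0 subr0; lra.
Qed.

End Run.

End Algorithm.

(** * Choice of parameters *)

Section ParameterChoice.
Variable R : realType.

(** Bernoulli's inequality in the form (1 - t)^m (1 + t m) <= 1. Mere existence is enough, because
    the chain length [n] enters the ancilla size and not the query count. *)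
Lemma geometric_small (t e : R) : 0 < t <= 1 -> 0 < e ->
  exists2 n : nat, (0 < n)%N & (1 - t) ^+ n <= e.
Proof.
move=> /andP[t0 t1] e0.
have bern m : (1 - t) ^+ m * (1 + t * m%:R) <= 1.
  elim: m => [|m IH]; first by rewrite expr0 mulr0 addr0 mulr1.
  apply: le_trans IH; rewrite exprS [_ * (1 - t) ^+ m]mulrC -mulrA.
  rewrite ler_wpM2l ?exprn_ge0 ?subr_ge0 // -natr1.
  by have := ler0n R m; nra.
exists (Num.trunc (t * e)^-1).+1 => //; set m := _.+1.
have lt_m : (t * e)^-1 < m%:R by exact: truncnS_gt.
have te0 : 0 < t * e by apply: mulr_gt0.
have : 1 < t * e * m%:R by rewrite -ltr_pdivrMl // mulr1.
have := bern m; have : 0 <= (1 - t) ^+ m by rewrite exprn_ge0 ?subr_ge0.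
set p := (1 - t) ^+ m; move=> p0 le_p lt1.
have te_le : t * e * m%:R * p <= e by nra.
nra.
Qed.

Lemma or_algorithm_correct (N k a n K : nat) (x0 : 'I_N) (al be S eps : R) :
  (n.*2 + K.*2 < 2 ^ a)%N -> (0 < n)%N -> (0 < K)%N ->
  0 < al -> al ^+ 2 * S = 1 -> S ^+ 2 = N%:R ->
  0 < be -> be ^+ 2 * (K.*2)%:R = 1 -> 0 < eps <= 2^-1 ->
  144 * S / eps <= K%:R ->
  4 * (1 - 2 * eps) ^+ n * S <= (12 * K%:R) ^- 2 ->
  forall (f : 'I_N -> bool) (O : qop R (ospace N k)),
    eps_biased_oracle f O eps ->
    2 / 3 <= prob_output (or_algorithm k a x0 n K al be) O (OR f).
Proof.
move=> room n0 K0 al0 alS SN be0 beK /andP[eps0 eps1] le_K le_n f O.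
case=> epsx [biasedO le_eps]; set d := signed_bias f epsx.
have normd x : `|d x| = 2 * epsx x.
  have epsx0 : 0 < epsx x by apply: lt_le_trans (le_eps x).
  rewrite /d /signed_bias normrM (gtr0_norm epsx0); congr (_ * _).
  by case: (f x); rewrite ?normrN ger0_norm.
have d1 x : `|d x| <= 1 by rewrite normd; have := bias_le biasedO x; lra.
have dq x : 1 - `|d x| <= 1 - 2 * eps by rewrite normd; have := le_eps x; lra.
have d_neq0 x : d x != 0 by rewrite -normr_gt0 normd; have := le_eps x; lra.
have sgd x : Num.sg (d x) = if f x then 1 else -1.
  have epsx0 : 0 < epsx x by apply: lt_le_trans (le_eps x).
  rewrite /d /signed_bias; case: (f x).
    by rewrite gtr0_sg // mulr_gt0.
  by rewrite ltr0_sg // mulNr oppr_lt0 mulr_gt0.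
have S0 : 0 < S by have := al0; nra.
have K0' : 0 < K%:R :> R by rewrite ltr0n.
have be1 : be <= 1.
  have : be ^+ 2 <= 1.
    by rewrite -beK ler_peMr ?sqr_ge0 // ler1n double_gt0.
  by nra.
have q01 : 0 <= 1 - 2 * eps <= 1 by apply/andP; split; lra.
(* Both values of OR need only a solution of the joint equations with squared norm [S], the square
   root of N. *)
suff main (kappa : 'I_N -> R) (theta : R) :
    \sum_x kappa x ^+ 2 = S ->
    theta = 2 * (1 - al * \sum_x kappa x * Num.sg (d x)) / (1 + al ^+ 2 * N%:R) ->
    (forall x, kappa x * Num.sg (d x) + theta * al = kappa x) ->
    1 - theta / 2 = (OR f)%:R ->
    2 / 3 <= prob_output (or_algorithm k a x0 n K al be) O (OR f).
  have al2N : al ^+ 2 * N%:R = S by rewrite -SN expr2 mulrA alS mul1r.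
  have [/existsP[x1 fx1]|none] := boolP [exists x, f x].
    (* Only the chain of one solution [x1] is excited; its weight 1 / al cancels the flag in the
       vertex product, so theta = 0. The squared norm is al^(-2) = S. *)
    apply: (main (fun x => (x == x1)%:R / al) 0).
    - rewrite (bigD1 x1) //= big1 ?addr0 => [|x /negbTE->].
        by rewrite eqxx mul1r; apply: (mulfI (lt0r_neq0 (exprn_gt0 2 al0)));
           rewrite alS -exprMn divff ?expr1n ?lt0r_neq0.
      by rewrite mul0r expr0n.
    - rewrite (bigD1 x1) //= big1 ?addr0 => [|x /negbTE->]; last by rewrite !mul0r.
      by rewrite eqxx sgd fx1 mulr1 mul1r divff ?lt0r_neq0 // subrr mulr0 mul0r.
    - move=> x; rewrite mul0r addr0; have [->|_] := eqVneq x x1; last by rewrite !mul0r.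
      by rewrite sgd fx1 mulr1.
    - by rewrite mul0r subr0 /OR; have -> : [exists x, f x] by apply/existsP; exists x1.
  have f0 x : f x = false by apply/negbTE/negP => fx; case/negP: none; apply/existsP; exists x.
  (* All chains reflect with sign -1 and carry [al], so the state is proportional to the vertex
     there and the flag is flipped. The squared norm is al^2 N, which al = N^(-1/4) balances with
     al^(-2). *)
  apply: (main (fun=> al) 2).
  - by rewrite sumr_const card_ord -mulr_natr al2N.
  - under eq_bigr => x _ do rewrite sgd f0.
    rewrite sumr_const card_ord -[_ *+ N]mulr_natl.
    have -> : 1 - al * (N%:R * (al * -1)) = 1 + al ^+ 2 * N%:R by ring.
    by rewrite al2N mulfK //; lra.
  - by move=> x; rewrite sgd f0; ring.
  - by rewrite /OR (negbTE none) divff ?pnatr_eq0 // subrr.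
move=> sum_kappa thetaE reflectE target.
(* Then be * c = 1/12 and K * eta = 1/12; with be <= 1 the total error is at most 1/6. *)
pose c := (12 * be)^-1; pose eta := (12 * K%:R)^-1 : R.
have c0 : 0 <= c by rewrite invr_ge0; nra.
have eta0 : 0 <= eta by rewrite invr_ge0; nra.
have le_eta : norm2 (truncation (k := k) (a := a) n f epsx kappa) <= eta ^+ 2.
  apply: le_trans (norm2_truncation k room kappa n0 d1 dq) _.
  by rewrite sum_kappa /eta exprVn.
have le_c : norm2 (catalyst (a := a) n f O epsx kappa) <= c ^+ 2.
  have := norm2_catalyst room biasedO kappa n0 d1 dq q01; rewrite sum_kappa.
  (* The catalyst has squared norm at most 2 S / eps, and 144 S / eps <= K brings this below K /
     72. *)
  have -> : c ^+ 2 = K%:R / 72.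
    rewrite /c exprVn exprMn.
    have -> : be ^+ 2 = ((K.*2)%:R)^-1.
      by apply: (mulIf (lt0r_neq0 (_ : 0 < (K.*2)%:R))); rewrite ?beK ?mulVf // ?ltr0n ?pnatr_eq0 -?lt0n ?double_gt0.
    by rewrite -muln2 natrM; field; lra.
  move: le_K; rewrite ler_pdivrMr // => le_K.
  have -> : 1 - (1 - 2 * eps) = 2 * eps by ring.
  set W := norm2 _ => le_W.
  rewrite -(ler_pM2l (_ : 0 < 2 * eps)); last by lra.
  by apply: le_trans le_W _; lra.
apply: (prob_output_ge room biasedO target (e := be * (K%:R * eta + c))) => //.
  have -> : K%:R * eta = 12^-1 by rewrite /eta; field; lra.
  have -> : be * (12^-1 + c) = be / 12 + 12^-1.
    by rewrite /c; field; lra.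
  by apply/andP; split; lra.
exact: (final_amplitude x0 room biasedO n0 d_neq0 thetaE reflectE beK (ltW be0) eta0 c0 le_eta le_c).
Qed.

End ParameterChoice.

(** The algorithm is fixed before [f] and [O]. Both bounds concern its exact count 2 (K + 1), with
    [K] just above 144 S / eps. *)
Lemma or_algorithm_exists (R : realType) (N k : nat) (eps : R) :
  (0 < N)%N -> 0 < eps <= 2^-1 ->
  exists (a : nat) (A : algorithm R N k a),
    [/\ valid_algorithm A,
        Num.sqrt N%:R / eps <= (queries A)%:R,
        (queries A)%:R <= 292 * Num.sqrt N%:R / eps &
        forall (f : 'I_N -> bool) (O : qop R (ospace N k)),
          eps_biased_oracle f O eps -> 2 / 3 <= prob_output A O (OR f)].
Proof.
move=> N0 /andP[eps0 eps1]; set S := Num.sqrt N%:R.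
have SN : S ^+ 2 = N%:R by rewrite sqr_sqrtr ?ler0n.
have S1 : 1 <= S by rewrite -sqrtr1 ler_wsqrtr // ler1n.
have S0 : 0 < S by apply: lt_le_trans S1.
(* This absorbs the additive 4 left in the query count by the rounding of [K] and the final two
   queries. *)
have Seps : 2 <= S / eps by rewrite ler_pdivlMr //; lra.
pose K := (Num.trunc (144 * S / eps)).+1.
have /andP[le_K lt_K] : (Num.trunc (144 * S / eps))%:R <= 144 * S / eps < K%:R.
  by apply: truncn_itv; rewrite -mulrA; lra.
have K0 : 0 < K%:R :> R by rewrite ltr0n.
(* The chain is long enough for each truncation to have norm at most 1 / (12 K). *)
have [n n0 le_n] : exists2 n, (0 < n)%N & (1 - 2 * eps) ^+ n <= (12 * K%:R) ^- 2 / (4 * S).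
  apply: geometric_small; first by apply/andP; split; lra.
  by rewrite divr_gt0 ?invr_gt0 ?exprn_gt0 ?mulr_gt0.
(* A generous ancilla: m < 2^m leaves room for all levels, all flags and [home]. *)
pose a := (n.*2 + K.*2)%N; pose al := Num.sqrt S^-1.
pose be : R := Num.sqrt ((K.*2)%:R)^-1.
have room : (n.*2 + K.*2 < 2 ^ a)%N by apply: ltn_expl.
pose x0 := Ordinal N0.
exists a, (or_algorithm k a x0 n K al be); split.
- exact: or_algorithm_valid.
- rewrite queries_or_algorithm -muln2 natrM -[K.+1%:R]natr1.
  by move: lt_K; rewrite -mulrA; lra.
- rewrite queries_or_algorithm -muln2 natrM -[K.+1%:R]natr1 -[K%:R]natr1.
  by move: le_K; rewrite -!mulrA; lra.
have K2 : 0 < (K.*2)%:R :> R by rewrite ltr0n double_gt0.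
apply: (or_algorithm_correct (S := S) x0 room n0) => //.
- by rewrite sqrtr_gt0 invr_gt0.
- by rewrite sqr_sqrtr ?invr_ge0 ?ltW // mulVf ?gt_eqF.
- by rewrite sqrtr_gt0 invr_gt0.
- by rewrite sqr_sqrtr ?invr_ge0 ?ltW // mulVf ?gt_eqF.
- by apply/andP.
- exact: ltW.
by move: le_n; rewrite ler_pdivlMr ?mulr_gt0 // mulrCA mulrA.
Qed.

Theorem theorem3 (R : realType) :
  (* O(sqrt N / eps) queries, given eps *)
  (exists c : R, 0 < c /\
    forall (N k : nat) (eps : R), (0 < N)%N -> 0 < eps <= 2^-1 ->
      exists (a : nat) (A : algorithm R N k a),
        [/\ valid_algorithm A,
            (queries A)%:R <= c * Num.sqrt (N%:R) / eps &
            forall (f : 'I_N -> bool) (O : qop R (ospace N k)),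
              eps_biased_oracle f O eps -> 2 / 3 <= prob_output A O (OR f)]) /\
  (* Theta(sqrt N / eps_min) queries, given eps_min *)
  (exists c1 c2 : R, 0 < c1 /\ 0 < c2 /\
    forall (N k : nat) (e : R), (0 < N)%N -> 0 < e <= 2^-1 ->
      exists (a : nat) (A : algorithm R N k a),
        [/\ valid_algorithm A,
            c1 * Num.sqrt (N%:R) / e <= (queries A)%:R,
            (queries A)%:R <= c2 * Num.sqrt (N%:R) / e &
            forall (f : 'I_N -> bool) (O : qop R (ospace N k)),
              oracle_with_min_bias f O e -> 2 / 3 <= prob_output A O (OR f)]).
Proof.
split; [exists 292; split=> // | exists 1, 292; split=> //; split=> //].
  move=> N k eps N0 eps_itv; have [a [A [validA _ leA okA]]] := or_algorithm_exists k N0 eps_itv.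
  by exists a, A; split.
move=> N k e N0 e_itv; have [a [A [validA geA leA okA]]] := or_algorithm_exists k N0 e_itv.
exists a, A; split=> [|||f O [epsx [biasedO [le_e _]]]] //; first by rewrite mul1r.
by apply: okA; exists epsx.
Qed.
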